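(* Let $\mathcal{L}$ be a finite congruence-uniform lattice. The core label order $\mathrm{CLO}(\mathcal{L})$ is a meet-semilattice if and only if $\mathcal{L}$ has the intersection property.
   Context: For a finite lattice $\mathcal{L}=(L,\leq)$, $\mathcal{J}(\mathcal{L})$ denotes the set of join-irreducible elements; each $j\in\mathcal{J}(\mathcal{L})$ has a unique lower cover $j_*$. For a cover relation $u\lessdot v$, $\mathrm{cg}(u,v)$ is the finest lattice congruence in which $u,v$ are equivalent, and $\mathrm{cg}(j)=\mathrm{cg}(j_*,j)$; the join-irreducible elements of the congruence lattice are exactly the $\mathrm{cg}(j)$. A finite lattice is congruence-uniform if $j\mapsto\mathrm{cg}(j)$ is a bijection from $\mathcal{J}(\mathcal{L})$ onto the join-irreducible congruences, for both $\mathcal{L}$ and its dual. For a cover $u\lessdot v$, $j_{\mathrm{cg}(u,v)}$ denotes the unique $j\in\mathcal{J}(\mathcal{L})$ with $\mathrm{cg}(j)=\mathrm{cg}(u,v)$. The nucleus of $x$ is $x_\downarrow=\bigwedge\{y\mid y\lessdot x\}$; the core label set is $\Psi(x)=\{j_{\mathrm{cg}(u,v)}\mid x_\downarrow\le u\lessdot v\le x\}$ (empty for $x=\hat0$). The core label order is $\mathrm{CLO}(\mathcal{L})=(L,\sqsubseteq)$ with $x\sqsubseteq y$ iff $\Psi(x)\subseteq\Psi(y)$. $\mathcal{L}$ has the intersection property if for all $x,y\in L$ there exists $z\in L$ with $\Psi(x)\cap\Psi(y)=\Psi(z)$. A meet-semilattice is a poset in which any two elements have a greatest lower bound. *)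

(* Defs.v *)
From mathcomp Require Import all_boot all_order.

Set Implicit Arguments.
Unset Strict Implicit.
Unset Printing Implicit Defensive.

Import Order.TTheory.
Local Open Scope order_scope.

Section Lattice.
Context {d : Order.disp_t} {L : finTBLatticeType d}.
Implicit Types (x y u v w j : L) (A B C : {set L * L}).

Definition covers u v : bool := (u < v) && [forall w, ~~ (u < w < v)].

Definition join_irreducible j : bool :=
  (j != \bot) &&
  [forall x, forall y, (j == x `|` y) ==> (j == x) || (j == y)].

(* j_*, the unique lower cover of j when j is join-irreducible (see
   [lower_starP]); the value is irrelevant otherwise. *)
Definition lower_star j : L := odflt j [pick u | covers u j].

(* Congruences are represented by their graphs; refinement of congruences is
   then inclusion of sets. *)
Definition congruence C : bool :=
  [&& [forall x, (x, x) \in C],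
      [forall x, forall y, ((x, y) \in C) ==> ((y, x) \in C)],
      [forall x, forall y, forall w,
         ((x, y) \in C) && ((y, w) \in C) ==> ((x, w) \in C)] &
      [forall x, forall y, forall u, forall v,
         ((x, y) \in C) && ((u, v) \in C) ==>
         ((x `&` u, y `&` v) \in C) && ((x `|` u, y `|` v) \in C)]].

Definition con_gen A : {set L * L} :=
  \bigcap_(C : {set L * L} | congruence C && (A \subset C)) C.

Definition con_bot : {set L * L} := [set p | p.1 == p.2].
Definition con_join A B : {set L * L} := con_gen (A :|: B).

Definition con_join_irreducible C : bool :=
  [&& congruence C, C != con_bot &
      [forall A : {set L * L}, forall B : {set L * L},
         [&& congruence A, congruence B & C == con_join A B] ==>
         (C == A) || (C == B)]].

Definition cg u v : {set L * L} := con_gen [set (u, v)].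
Definition cgj j : {set L * L} := cg (lower_star j) j.

Definition cgj_bijective : Prop :=
  [/\ forall j, join_irreducible j -> con_join_irreducible (cgj j),
      {in join_irreducible &, injective cgj} &
      forall C, con_join_irreducible C ->
        exists2 j, join_irreducible j & cgj j = C].

(* j = j_{cg(u, v)}; at most one such j exists when [cgj] is injective on the
   join-irreducible elements. *)
Definition cover_label u v j : bool :=
  join_irreducible j && (cgj j == cg u v).

Definition nucleus x : L := \meet_(y | covers y x) y.

(* For x = \bot the nucleus is the empty meet \top, but no v <= \bot covers
   anything, so the core label set is empty (see [core_labels_bot]). *)
Definition core_labels x : {set L} :=
  [set j | [exists u, exists v,
     [&& nucleus x <= u, covers u v, v <= x & cover_label u v j]]].

Definition core_label_order : rel L :=
  fun x y => core_labels x \subset core_labels y.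

Lemma lower_starP j : join_irreducible j ->
  forall y, covers y j = (y == lower_star j).
Proof.
move=> /andP[j0 /forallP jirr].
have uniq_cov u v : covers u j -> covers v j -> u = v.
  move=> /andP[uj /forallP mu] /andP[vj /forallP mv].
  have uvj : u `|` v < j.
    rewrite lt_neqAle leUx !ltW // !andbT; apply/eqP => e.
    have /forallP/(_ v) := jirr u; rewrite e eqxx /=.
    by rewrite (gt_eqF uj) (gt_eqF vj).
  have := mu (u `|` v); rewrite uvj andbT lt_neqAle leUl andbT negbK => /eqP uE.
  have := mv (u `|` v); rewrite uvj andbT lt_neqAle leUr andbT negbK => /eqP vE.
  by rewrite {1}uE -vE.
rewrite /lower_star; case: pickP => /= [u cu y|no].
  apply/idP/eqP => [cy|-> //]; exact: uniq_cov.
have b0 : \bot < j by rewrite lt0x.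
pose down u := #|[set w | w <= u]|.
have [u uj mu] := @arg_maxnP L \bot (fun u => u < j) down b0.
have := no u; rewrite /covers uj /= => /negbT.
rewrite negb_forall => /existsP[w]; rewrite negbK => /andP[uw wj].
have /negP[] : ~~ (down u >= down w)%N; last exact: mu.
rewrite -ltnNge; apply: proper_card; apply/properP; split.
  by apply/subsetP => t; rewrite !inE => /le_trans; apply; apply: ltW.
by exists w; rewrite !inE ?lexx // (lt_geF uw).
Qed.

Lemma congruenceP C : reflect
  [/\ forall x, (x, x) \in C,
      forall x y, (x, y) \in C -> (y, x) \in C,
      forall x y w, (x, y) \in C -> (y, w) \in C -> (x, w) \in C &
      forall x y u v, (x, y) \in C -> (u, v) \in C ->
        (x `&` u, y `&` v) \in C /\ (x `|` u, y `|` v) \in C]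
  (congruence C).
Proof.
apply: (iffP and4P) => [[r s t c]|[r s t c]]; split.
- by move=> x; move/forallP: r; apply.
- by move=> x y; move/'forall_'forall_implyP: s; apply.
- move=> x y w xy yw.
  move/forallP/(_ x)/forallP/(_ y)/forallP/(_ w)/implyP: t; apply.
  by rewrite xy.
- move=> x y u v xy uv; apply/andP.
  move/forallP/(_ x)/forallP/(_ y)/forallP/(_ u)/forallP/(_ v)/implyP: c.
  by apply; rewrite xy.
- exact/forallP.
- by apply/'forall_'forall_implyP.
- apply/forallP => x; apply/forallP => y; apply/forallP => w.
  by apply/implyP => /andP[]; apply: t.
- apply/forallP => x; apply/forallP => y; apply/forallP => u.
  apply/forallP => v; apply/implyP => /andP[xy uv]; apply/andP; exact: c.
Qed.

Lemma con_genP A :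
  [/\ congruence (con_gen A), A \subset con_gen A &
      forall C, congruence C -> A \subset C -> con_gen A \subset C].
Proof.
split; last by move=> C cC AC; apply: bigcap_inf; rewrite cC.
  apply/congruenceP; split.
  - by move=> x; apply/bigcapP => C /andP[/congruenceP[r _ _ _] _]; apply: r.
  - move=> x y /bigcapP xy; apply/bigcapP => C hC.
    by have /andP[/congruenceP[_ s _ _] _] := hC; apply: s; apply: xy.
  - move=> x y w /bigcapP xy /bigcapP yw; apply/bigcapP => C hC.
    have /andP[/congruenceP[_ _ t _] _] := hC.
    by apply: t (xy _ hC) (yw _ hC).
  - move=> x y u v /bigcapP xy /bigcapP uv.
    by split; apply/bigcapP => C hC;
      have /andP[/congruenceP[_ _ _ c] _] := hC;
      have [] := c _ _ _ _ (xy _ hC) (uv _ hC).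
by apply/bigcapsP => C /andP[].
Qed.

Lemma core_labels_bot : core_labels \bot = set0.
Proof.
apply/setP => j; rewrite !inE; apply/negbTE/existsP => -[u /existsP[v]].
case/and4P => _ /andP[uv _] /(lt_le_trans uv); by rewrite ltx0.
Qed.

End Lattice.

Definition congruence_uniform (d : Order.disp_t) (L : finTBLatticeType d) :
  Prop := @cgj_bijective d L /\ @cgj_bijective _ L^d.

Definition intersection_property (d : Order.disp_t) (L : finTBLatticeType d) :
  Prop :=
  forall x y : L, exists z : L, core_labels x :&: core_labels y = core_labels z.

Definition partial_order (T : Type) (r : rel T) : Prop :=
  [/\ reflexive r, antisymmetric r & transitive r].

Definition is_glb (T : Type) (r : rel T) (x y z : T) : Prop :=
  [/\ r z x, r z y & forall w, r w x -> r w y -> r w z].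

Definition meet_semilattice (T : Type) (r : rel T) : Prop :=
  partial_order r /\ forall x y, exists z, is_glb r x y z.

(* Main.v *)
Require Import Defs.
From mathcomp Require Import all_boot all_order.

(** Every cover [u < v] is perspective to [j_* < j] for any [j] minimal among
    the elements below [v] but not below [u].  Injectivity of [cgj] makes this
    [j] the label of the cover, so labels of [u < v] lie below [v] and not below
    [u].  Hence [core_labels x \subset core_labels y] forces [x <= y]: otherwise
    the label of a lower cover of [x] above [x `&` y] would lie below both [x]
    and [y].  Since moreover [core_labels j = [set j]] for [j] join-irreducible,
    a greatest lower bound of [x] and [y] in the core label order must carry
    every label common to [x] and [y]. *)

Set Implicit Arguments.
Unset Strict Implicit.
Unset Printing Implicit Defensive.

Import Order.TTheory.
Local Open Scope order_scope.

Section CoreLabels.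
Context {d : Order.disp_t} {L : finTBLatticeType d}.
Implicit Types (x y u v w j k : L).

(** The size of the principal down-set is a strictly increasing integer rank; optimising it yields
    minimal and maximal elements of any inhabited predicate. *)
Lemma card_downset_lt u v :
  u < v -> (#|[set w : L | (w <= u)%O]| < #|[set w : L | (w <= v)%O]|)%N.
Proof.
move=> uv; apply/proper_card/properP; split.
  by apply/subsetP => t; rewrite !inE => /le_trans; apply; apply: ltW.
by exists v; rewrite !inE ?lexx // (lt_geF uv).
Qed.

Lemma exists_minimal (P : pred L) x :
  P x -> exists2 m, P m & forall w, w < m -> ~~ P w.
Proof.
move=> Px; pose down u := #|[set w : L | w <= u]|.
have [m Pm mm] := @arg_minnP L x P down Px.
exists m => // w wm; apply/negP => /mm.
by rewrite leqNgt card_downset_lt.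
Qed.

Lemma exists_maximal (P : pred L) x :
  P x -> exists2 m, P m & forall w, m < w -> ~~ P w.
Proof.
move=> Px; pose down u := #|[set w : L | w <= u]|.
have [m Pm mm] := @arg_maxnP L x P down Px.
exists m => // w wm; apply/negP => /mm.
by rewrite /= leqNgt card_downset_lt.
Qed.

Lemma exists_lower_cover u x : u < x -> exists2 w, u <= w & covers w x.
Proof.
move=> ux; have Pu : (u <= u) && (u < x) by rewrite lexx.
have [w /andP[uw wx] mw] :=
  @exists_maximal (fun w => (u <= w) && (w < x)) u Pu.
exists w => //; rewrite /covers wx; apply/forallP => t; apply/negP.
by case/andP => wt tx; have := mw t wt; rewrite tx (le_trans uw (ltW wt)).
Qed.

Lemma lower_star_covers j : join_irreducible j -> covers (lower_star j) j.
Proof. by move=> ji; rewrite lower_starP. Qed.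

Lemma cg_sub u v (C : {set L * L}) :
  congruence C -> (u, v) \in C -> cg u v \subset C.
Proof.
by move=> cC uvC; case: (con_genP [set (u, v)]) => _ _; apply;
  rewrite ?sub1set.
Qed.

Lemma mem_cg u v : (u, v) \in cg u v.
Proof. by case: (con_genP [set (u, v)]) => _; rewrite sub1set. Qed.

Lemma cg_congruence u v : congruence (cg u v).
Proof. by case: (con_genP [set (u, v)]). Qed.

(** Joining with [u] carries the left generating pair to the right one, and meeting with [j] carries
    it back, so each congruence contains the generator of the other. *)
Lemma cg_perspective u j : cg (j `&` u) j = cg u (j `|` u).
Proof.
apply/eqP; rewrite eqEsubset !cg_sub ?cg_congruence //.
- have /congruenceP[r _ _ c] := cg_congruence (j `&` u) j.
  have [_] := c _ _ _ _ (mem_cg (j `&` u) j) (r u).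
  by rewrite (join_r (leIr u j)).
- have /congruenceP[r _ _ c] := cg_congruence u (j `|` u).
  have [+ _] := c _ _ _ _ (r j) (mem_cg u (j `|` u)).
  by rewrite (meet_l (leUl j u)).
Qed.

Lemma exists_cover_label u v :
  covers u v -> exists j, [/\ cover_label u v j, j <= v & ~~ (j <= u)].
Proof.
move=> /andP[uv /forallP muv].
have Pv : (v <= v) && ~~ (v <= u) by rewrite lexx (lt_geF uv).
have [j /andP[jv ju] mj] :=
  @exists_minimal (fun w => (w <= v) && ~~ (w <= u)) v Pv.
(* Minimality of [j]. A join of two elements strictly below [j] then stays below [u], so it cannot
   be [j]: this is why [j] is join-irreducible. *)
have below w : w < j -> w <= u.
  by move=> wj; have := mj w wj; rewrite (le_trans (ltW wj) jv) negbK.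
have ji : join_irreducible j.
  apply/andP; split; first by apply: contraNneq ju => ->; apply: le0x.
  apply/'forall_'forall_implyP => a b /eqP jab.
  apply/negPn/negP; rewrite negb_or => /andP[ja jb].
  case/negP: ju; rewrite {1}jab leUx.
  by rewrite !below // lt_neqAle eq_sym ?ja ?jb jab ?leUl ?leUr.
have juv : j `|` u = v.
  apply/eqP; have := muv (j `|` u); rewrite negb_and.
  rewrite lt_neqAle leUr andbT negbK lt_neqAle leUx jv ltW //= andbT negbK.
  by case/orP => // /eqP uE; rewrite uE leUl in ju.
(* By [below], [lower_star j] lies under [u], hence under the meet; the meet is not [j], so the
   cover leaves only equality. *)
have jstar : lower_star j = j `&` u.
  have /andP[sj /forallP ms] := lower_star_covers ji.
  have := ms (j `&` u); rewrite negb_and [_ `&` _ < j]lt_neqAle leIl andbT.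
  have -> : j `&` u != j by apply: contraNneq ju => <-; rewrite leIr.
  by rewrite orbF lt_neqAle lexI (ltW sj) below //= andbT negbK => /eqP.
by exists j; rewrite /cover_label ji /cgj jstar cg_perspective juv eqxx.
Qed.

Context (cgj_inj : {in @join_irreducible d L &, injective cgj}).

(** Injectivity of [cgj] identifies any label of the cover with the one built in
    [exists_cover_label]. *)
Lemma cover_label_le u v j :
  covers u v -> cover_label u v j -> (j <= v) && ~~ (j <= u).
Proof.
move=> /exists_cover_label[k [/andP[ki /eqP kE] kv ku]] /andP[ji /eqP jE].
by rewrite (cgj_inj ji ki) ?kv //; rewrite jE kE.
Qed.

Lemma core_labels_le x j : j \in core_labels x -> j <= x.
Proof.
rewrite inE => /existsP[u /existsP[v /and4P[_ cuv vx lj]]].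
by have /andP[jv _] := cover_label_le cuv lj; apply: le_trans vx.
Qed.

Lemma core_label_order_le x y : core_label_order x y -> x <= y.
Proof.
move=> /subsetP xy; apply/negPn/negP => nxy.
have xyx : x `&` y < x.
  by rewrite lt_neqAle leIl andbT; apply: contraNneq nxy => <-; apply: leIr.
have [w xyw cwx] := exists_lower_cover xyx.
have [j [lj jx jw]] := exists_cover_label cwx.
(* It suffices that [j] lies below [y], which holds once [j] is a core label of [x], since that
   label passes to [y]. *)
case/negP: jw; apply: le_trans xyw; rewrite lexI jx /=.
apply/core_labels_le/xy; rewrite inE.
apply/existsP; exists w; apply/existsP; exists x.
by rewrite cwx lj lexx !andbT; apply: meets_inf.
Qed.

Lemma core_label_order_partial_order : partial_order (@core_label_order d L).
Proof.
split.
- by move=> x; apply: subxx.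
- move=> x y /andP[xy yx]; apply/le_anti.
  by rewrite !core_label_order_le.
- by move=> y x z; apply: subset_trans.
Qed.

Lemma core_labels_join_irreducible j :
  join_irreducible j -> core_labels j = [set j].
Proof.
move=> ji; have cj := lower_star_covers ji; have /andP[sj /forallP ms] := cj.
(* The meet runs over a single lower cover, so the only cover between the nucleus and [j] is
   [lower_star j < j]. *)
have nucE : nucleus j = lower_star j.
  by rewrite /nucleus (big_pred1 (lower_star j)) //; apply: lower_starP.
apply/setP => k; rewrite !inE nucE; apply/existsP/eqP => [[u /existsP[v]]|->].
- case/and4P=> su /andP[uv _] vj /andP[ki /eqP kE]; apply: cgj_inj => //.
  have vE : v = j.
    have := ms v; rewrite (le_lt_trans su uv) /= lt_neqAle vj andbT negbK.
    by move/eqP.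
  have uE : u = lower_star j.
    have := ms u; rewrite -{2}vE uv andbT lt_neqAle su andbT negbK.
    by move/eqP.
  by rewrite kE vE uE.
- exists (lower_star j); apply/existsP; exists j.
  by rewrite !lexx cj /cover_label ji eqxx.
Qed.

Lemma mem_core_labels_join_irreducible x j :
  j \in core_labels x -> join_irreducible j.
Proof. by rewrite inE => /existsP[u /existsP[v /and4P[_ _ _ /andP[]]]]. Qed.

Lemma is_glb_core_labels x y z :
  is_glb core_label_order x y z <->
  core_labels x :&: core_labels y = core_labels z.
Proof.
split=> [[zx zy glb]|E].
- apply/eqP; rewrite eqEsubset subsetI; apply/and3P; split=> //.
  apply/subsetP => j /setIP[jx jy].
  have jE := core_labels_join_irreducible (mem_core_labels_join_irreducible jx).
  (* The common label [j], taken as a lattice element, is itself a lower bound of [x] and [y], so it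
     is below [z] in the core label order. *)
  have := glb j; rewrite /core_label_order jE !sub1set; exact.
- by split=> [||w wx wy];
    rewrite /core_label_order -E ?subsetIl ?subsetIr // subsetI; apply/andP.
Qed.

End CoreLabels.

Theorem theorem4p8 (d : Order.disp_t) (L : finTBLatticeType d)
  (hL : congruence_uniform L) :
  meet_semilattice (@core_label_order d L) <-> intersection_property L.
Proof.
have [[_ cgj_inj _] _] := hL; split=> [[_ glb] x y|ip].
  by have [z /(is_glb_core_labels cgj_inj)] := glb x y; exists z.
split=> [|x y]; first exact: core_label_order_partial_order.
by have [z /(is_glb_core_labels cgj_inj)] := ip x y; exists z.
Qed.
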